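(* A hedgegraph $G=(V,E)$ is $1$-partition connected if and only if there is a subset $F\subseteq E$ such that the sub-hedgegraph $(V,F)$ has a trimming that is a spanning tree on $V$.
   Context: A hedgegraph $G=(V,E)$ consists of a finite vertex set $V$ and a finite set $E$ of hedges; each hedge is a set of hyperedges (subsets of $V$), the hyperedges within one hedge are pairwise vertex-disjoint, and no hyperedge belongs to two hedges. For a partition $\mathcal{P}$ of $V$ into nonempty parts, $\delta(\mathcal{P})$ is the set of hedges containing a hyperedge that intersects at least two parts of $\mathcal{P}$. $G$ is $1$-partition connected if $|\delta(\mathcal{P})|\ge |\mathcal{P}|-1$ for every partition $\mathcal{P}$ of $V$. A trimming of a hedge $e$ chooses one hyperedge $h\in e$ and two distinct vertices $u,v\in h$ and replaces $e$ by the single edge $\{u,v\}$; a trimming of a hedgegraph $(V,F)$ trims every hedge of $F$ (no hedge is deleted), yielding a multigraph on $V$ with exactly $|F|$ edges. *)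

(* Defs.v *)
From mathcomp Require Import all_boot.

Set Implicit Arguments.
Unset Strict Implicit.
Unset Printing Implicit Defensive.

Section Hedgegraphs.

Variable V : finType.

Notation hedge := {set {set V}}.

(* Distinct hedges are disjoint sets of hyperedges, so a set (rather than a    *)
(* family) of hedges loses no generality, except that at most one hedge may    *)
(* be empty.  Empty and singleton hyperedges are allowed.                      *)
Record hedgegraph := Hedgegraph {
  hedges :> {set hedge};
  hedge_trivIset : {in hedges, forall e : hedge, trivIset e};
  hedges_disjoint : {in hedges &, forall e f : hedge, e != f -> [disjoint e & f]}
}.

Definition delta (G : hedgegraph) (P : {set {set V}}) : {set hedge} :=
  [set e in hedges G |
    [exists h in e, 2 <= #|[set A in P | h :&: A != set0]|]].

(* The truncated subtraction only matters for P = set0, i.e. V empty, where    *)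
(* the inequality holds with either reading.                                   *)
Definition one_partition_connected (G : hedgegraph) : Prop :=
  forall P : {set {set V}}, partition P [set: V] -> #|P| - 1 <= #|delta G P|.

Fact sub_hedge_trivIset (G : hedgegraph) (F : {set hedge}) :
  F \subset hedges G -> {in F, forall e : hedge, trivIset e}.
Proof. by move=> /subsetP sFG e /sFG; apply: hedge_trivIset. Qed.

Fact sub_hedges_disjoint (G : hedgegraph) (F : {set hedge}) :
  F \subset hedges G -> {in F &, forall e f : hedge, e != f -> [disjoint e & f]}.
Proof. by move=> /subsetP sFG e f /sFG Ge /sFG; apply: hedges_disjoint. Qed.

Definition sub_hedgegraph (G : hedgegraph) (F : {set hedge})
    (sFG : F \subset hedges G) : hedgegraph :=
  Hedgegraph (sub_hedge_trivIset sFG) (sub_hedges_disjoint sFG).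

(* Loopless multigraphs: parallel edges are distinct elements of mg_edge       *)
(* having the same set of ends.                                                *)
Record multigraph := Multigraph {
  mg_edge : finType;
  mg_ends : mg_edge -> {set V};
  card_mg_ends : forall a, #|mg_ends a| = 2
}.

Definition mg_adj (M : multigraph) : rel V :=
  [rel x y | [exists a : mg_edge M, mg_ends a == [set x; y]]].

Definition mg_connected (M : multigraph) : Prop :=
  forall x y : V, connect (mg_adj M) x y.

(* c = [:: (x_1, a_1); ...; (x_k, a_k)] stands for the closed walk             *)
(* x_1 -a_1- x_2 -a_2- ... x_k -a_k- x_1.  Since there are no loops, k >= 2,   *)
(* and k = 2 is a pair of parallel edges.                                      *)
Definition mg_cycle (M : multigraph) (c : seq (V * mg_edge M)) : bool :=
  [&& c != [::], uniq (unzip1 c), uniq (unzip2 c) &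
      cycle [rel p q | mg_ends p.2 == [set p.1; q.1]] c].

Definition mg_acyclic (M : multigraph) : Prop :=
  forall c : seq (V * mg_edge M), ~~ mg_cycle c.

(* The vertex set of M is all of V, so a tree is spanning; the empty graph     *)
(* counts as a tree when V is empty.                                           *)
Definition spanning_tree (M : multigraph) : Prop :=
  mg_connected M /\ mg_acyclic M.

Definition trims (e : hedge) (d : {set V}) : Prop :=
  exists h u v, [/\ h \in e, u \in h, v \in h, u != v & d = [set u; v]].

Record trimming (G : hedgegraph) := Trimming {
  trim : {e : hedge | e \in hedges G} -> {set V};
  trimP : forall e, trims (val e) (trim e)
}.

Fact card_trim (G : hedgegraph) (t : trimming G) e : #|trim t e| = 2.
Proof.
by have [h [u [v [_ _ _ nuv ->]]]] := trimP t e; rewrite cards2 nuv.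
Qed.

Definition trimmed (G : hedgegraph) (t : trimming G) : multigraph :=
  Multigraph (card_trim t).

End Hedgegraphs.

(* Main.v *)
(** A trimming chooses one pair of vertices for each hedge, so we look at
    coloured pairs: the hedges are the colours and a pair has colour [e] when it
    lies inside a hyperedge of [e].  Call a set of coloured pairs rich when every
    map [f] on [V] with [k] values separates pairs of at least [k - 1] colours
    (maps play the role of partitions).  Take an inclusion-minimal rich set.  As
    in Rado's theorem, it has at most one pair of each colour: if removing either
    of two pairs of colour [i] destroyed richness, there would be tight maps [f]
    and [g] such that no pair of colour [i] is separated by both, and then the
    common refinement and the join of [f] and [g] together would separate too few
    colours.  With one pair per colour, rich means connected, so by minimality
    no edge lies on a cycle. *)

Require Import Defs.
From mathcomp Require Import all_boot.

Set Implicit Arguments.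
Unset Strict Implicit.
Unset Printing Implicit Defensive.

(** * Contracting and joining maps on a finite set *)

Lemma leq_card_imset_factor (V T U : finType) (f : V -> T) (g : V -> U) (A : {set V}) :
  (forall x y, g x = g y -> f x = f y) -> #|f @: A| <= #|g @: A|.
Proof.
move=> fg; pose k z := omap f [pick x | g x == z].
have kg x : k (g x) = Some (f x).
  rewrite /k; case: pickP => [y /eqP/fg /= -> //|/(_ x)]; by rewrite eqxx.
have someI : injective (@Some T) by move=> ? ? [].
rewrite -(card_imset _ someI) -imset_comp.
by rewrite -(eq_imset _ kg) imset_comp leq_imset_card.
Qed.

(** Induction on [s]: collapsing the image of one more set [d] to a single point loses at most
    [#|d| - 1] values, and nothing when [d] is empty. *)
Lemma contract_sets (T : finType) (s : seq {set T}) :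
  exists2 g : T -> T,
    {in s, forall d : {set T}, {in d &, forall x y, g x = g y}} &
    forall A : {set T}, #|A| <= #|g @: A| + \sum_(d <- s) #|d|.-1.
Proof.
elim: s => [|d s [g gs leg]].
  by exists id => // A; rewrite imset_id big_nil addn0.
have [->|[b db]] := set_0Vmem d.
  exists g => [e|A]; last by rewrite big_cons cards0.
  by rewrite inE => /orP[/eqP->|/gs //] x y; rewrite inE.
pose m y := if y \in g @: d then g b else y.
exists (m \o g) => [e|A].
  rewrite inE => /orP[/eqP->|/gs ge] x y ex ey /=; last by rewrite (ge x y).
  by rewrite /m !imset_f.
apply: leq_trans (leg A) _; rewrite big_cons addnA leq_add2r.
(* The only values that [m] can lose lie in the image of [d] and differ from [g b]. *)
have sub : g @: A \subset (m \o g) @: A :|: (g @: d :\ g b).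
  apply/subsetP=> _ /imsetP[x Ax ->]; rewrite !inE.
  have [gxd|gxd] := boolP (g x \in g @: d); last first.
    by apply/orP; left; apply/imsetP; exists x; rewrite //= /m (negPf gxd).
  have [gxb|] := eqVneq (g x) (g b); last by rewrite orbT.
rewrite orbF.
  by apply/imsetP; exists x; rewrite //= /m gxd.
apply: leq_trans (subset_leq_card sub) _; rewrite cardsU.
apply: leq_trans (leq_subr _ _) _; rewrite leq_add2l.
rewrite cardsDS ?sub1set ?imset_f // cards1 subn1.
by rewrite -!subn1 leq_sub2r // leq_imset_card.
Qed.

(* [k] merges values of [f] with values of [g]; [k \o inl \o f] is the join.   *)
Lemma card_join (V T U : finType) (f : V -> T) (g : V -> U) :
  exists2 h : V -> T + U,
    forall x y, f x = f y \/ g x = g y -> h x = h y &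
    #|f @: setT| + #|g @: setT| <=
      #|(fun x => (f x, g x)) @: setT| + #|h @: setT|.
Proof.
(* Consider the bipartite graph on the values of [f] and of [g], with one edge per joint value.
   Contracting an edge loses at most one vertex, and what remains are values of the join. *)
pose fg x := (f x, g x); pose pair_set (p : T * U) := [set inl p.1; inr p.2].
have [k ks lek] := contract_sets [seq pair_set p | p <- enum (fg @: setT)].
have kfg x : k (inl (f x)) = k (inr (g x)).
  apply: (ks (pair_set (fg x))); rewrite ?inE ?eqxx ?orbT //.
  by apply: map_f; rewrite mem_enum imset_f.
exists (k \o inl \o f) => [x y [] /= fxy|]; first by rewrite fxy.
  by rewrite !kfg fxy.
have inl_inj : injective (@inl T U) by move=> ? ? [].
have inr_inj : injective (@inr T U) by move=> ? ? [].
pose A : {set T + U} := inl @: (f @: setT) :|: inr @: (g @: setT).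
have cardA : #|A| = #|f @: setT| + #|g @: setT|.
  rewrite cardsU (card_imset _ inl_inj) (card_imset _ inr_inj).
  rewrite (_ : _ :&: _ = set0) ?cards0 ?subn0 //.
  apply/setP=> z; rewrite !inE; apply/negP=> /andP[/imsetP[? _ ->]].
  by case/imsetP.
rewrite -cardA addnC; apply: leq_trans (lek A) _; apply: leq_add.
  apply/subset_leq_card/subsetP=> _ /imsetP[z Az ->].
  by move: Az; rewrite inE => /orP[] /imsetP[_ /imsetP[x _ ->] ->];
    apply/imsetP; exists x; rewrite //= kfg.
rewrite big_map big_enum /= -sum1_card leq_sum // => p _.
by rewrite cards2.
Qed.

(** * Edges separated by a map *)

Definition separates (V : finType) (T : eqType) (f : V -> T) (d : {set V}) : bool :=
  [exists u in d, [exists v in d, f u != f v]].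

Lemma separatesP (V : finType) (T : eqType) (f : V -> T) (d : {set V}) :
  reflect (exists u v, [/\ u \in d, v \in d & f u != f v]) (separates f d).
Proof.
apply: (iffP exists_inP) => [[u du /exists_inP[v dv fuv]]|[u [v [du dv fuv]]]].
  by exists u, v.
by exists u => //; apply/exists_inP; exists v.
Qed.

(* Contracting the separated edges makes [f] constant, at the cost of at most
   one value per edge. *)
Lemma connected_card_separated (V E T : finType) (ends : E -> {set V})
    (B : {set E}) (f : V -> T) :
  (forall a, #|ends a| = 2) ->
  (forall x y, connect [rel u v | [exists a in B, ends a == [set u; v]]] x y) ->
  #|f @: setT| <= #|[set a in B | separates f (ends a)]|.+1.
Proof.
move=> card_ends conn; set C := [set a in B | _].
have [g gs leg] := contract_sets [seq f @: ends a | a <- enum C].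
have gf x y : g (f x) = g (f y).
  have /connectP[p + ->] := conn x y; elim: p x => [//|z p IHp] x /=.
  case/andP=> /exists_inP[a Ba /eqP aE] /IHp <-.
  have xa : x \in ends a by rewrite aE !inE eqxx.
  have za : z \in ends a by rewrite aE !inE eqxx orbT.
  have [->//|fxz] := eqVneq (f x) (f z).
  apply: (gs (f @: ends a)); rewrite ?imset_f //.
  apply/map_f; rewrite mem_enum inE Ba; apply/separatesP; by exists x, z.
apply: leq_trans (leg _) _; rewrite -add1n; apply: leq_add.
  rewrite -imset_comp; apply/card_le1_eqP => _ _ /imsetP[x _ ->] /imsetP[y _ ->].
  exact: gf.
rewrite big_map big_enum /= -sum1_card leq_sum // => a _.
rewrite -subn1 leq_subLR addn1; apply: leq_trans (leq_imset_card _ _) _.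
by rewrite card_ends.
Qed.

(** * Minimal rich sets of coloured pairs *)

Section ColouredPairs.

Variables V I : finType.
Implicit Types (S : {set I * {set V}}) (i : I) (d : {set V}).

Definition crossed (T : eqType) (f : V -> T) S : {set I} :=
  [set i | [exists d, ((i, d) \in S) && separates f d]].

Lemma crossedP (T : eqType) (f : V -> T) S i :
  reflect (exists2 d, (i, d) \in S & separates f d) (i \in crossed f S).
Proof.
rewrite inE; apply: (iffP existsP) => [[d /andP[]]|[d Sd fd]]; exists d => //.
by rewrite Sd.
Qed.

Lemma crossed_factor (T U : eqType) (f : V -> T) (g : V -> U) S :
  (forall x y, g x = g y -> f x = f y) -> crossed f S \subset crossed g S.
Proof.
move=> fg; apply/subsetP=> i /crossedP[d Sd /separatesP[u [v [du dv fuv]]]].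
apply/crossedP; exists d => //; apply/separatesP; exists u, v; split => //.
by apply: contra fuv => /eqP/fg->.
Qed.

(** The fixed codomain [{set V}] makes the maps range over a finite type, so that [rich] is Boolean
    and [minset] applies to it. *)
Definition rich S : bool :=
  [forall f : {ffun V -> {set V}}, #|f @: setT| <= #|crossed f S|.+1].

(* A map into any finite type has the same fibres as the map sending a point
   to its fibre. *)
Lemma richP S :
  reflect (forall (T : finType) (f : V -> T), #|f @: setT| <= #|crossed f S|.+1)
          (rich S).
Proof.
apply: (iffP forallP) => [richS T f|richS f]; last exact: richS.
pose fib := [ffun x => f @^-1: [set f x]].
have fib_f x y : fib x = fib y -> f x = f y.
  rewrite !ffunE => /setP/(_ x); rewrite !inE eqxx => /esym/eqP; exact.
have f_fib x y : f x = f y -> fib x = fib y by rewrite !ffunE => ->.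
apply: leq_trans (leq_card_imset_factor _ fib_f) _.
apply: leq_trans (richS fib) _; rewrite ltnS.
exact/subset_leq_card/crossed_factor.
Qed.

(** Take for [f] a map violating richness once [(i, d)] is removed. The removal can cost only the
    colour [i], so [f] is tight for [S]; and it must cost that colour, so [d] is the only pair of
    colour [i] that [f] separates. *)
Lemma minset_rich_tight S i d :
  minset rich S -> (i, d) \in S ->
  exists f : {ffun V -> {set V}},
    [/\ #|crossed f S| < #|f @: setT|, separates f d &
        forall d', (i, d') \in S -> separates f d' -> d' = d].
Proof.
move=> /minsetP[richS minS] Sd; pose S' := S :\ (i, d).
have /forallPn[f] : ~~ rich S'.
  apply/negP=> richS'; have := minS _ richS' (subD1set _ _).
  by move/setP/(_ (i, d)); rewrite Sd !inE eqxx.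
rewrite -ltnNge => ltf; exists f.
have not_sub : ~ crossed f S \subset crossed f S'.
  move=> sub; move: ltf; rewrite ltnNge => /negP; apply.
  apply: leq_trans (forallP richS f) _; rewrite ltnS; exact: subset_leq_card.
have sub : crossed f S \subset i |: crossed f S'.
  apply/subsetP=> j /crossedP[d' Sd' fd']; rewrite in_setU1.
  have [//|ji] := eqVneq j i; apply/crossedP; exists d' => //.
  by rewrite !inE Sd' xpair_eqE (negPf ji).
split=> [||d' Sd' fd'].
- apply: leq_ltn_trans (subset_leq_card sub) (leq_ltn_trans _ ltf).
  by rewrite cardsU1; case: (i \notin _).
- apply: contraT => nfd; case: not_sub; apply/subsetP=> j /crossedP[e Se fe].
  apply/crossedP; exists e => //; rewrite !inE Se andbT.
  by apply: contraNneq nfd => -[_ <-].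
- apply/eqP/contraT=> d'd; case: not_sub; apply: (subset_trans sub).
  rewrite subUset subxx andbT sub1set; apply/crossedP; exists d' => //.
  by rewrite !inE Sd' xpair_eqE (negPf d'd) andbF.
Qed.

Lemma minset_rich_inj S i d d' :
  minset rich S -> (i, d) \in S -> (i, d') \in S -> d = d'.
Proof.
move=> minS Sd Sd'; apply/eqP/negPn/negP=> dd'.
have [f [tight_f sep_fd fd]] := minset_rich_tight minS Sd.
have [g [tight_g sep_gd' gd']] := minset_rich_tight minS Sd'.
have /minsetP[/richP richS _] := minS.
have [h hfg le_fg] := card_join f g.
pose fg x := (f x, g x).
have crossed_fg : crossed fg S \subset crossed f S :|: crossed g S.
  apply/subsetP=> j /crossedP[e Se /separatesP[u [v [eu ev]]]].
  rewrite xpair_eqE negb_and inE => /orP[fuv|guv]; apply/orP; [left|right];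
  by apply/crossedP; exists e => //; apply/separatesP; exists u, v.
have sep_h e : separates h e -> separates f e /\ separates g e.
  case/separatesP=> u [v [eu ev huv]].
  by split; apply/separatesP; exists u, v; split=> //; apply: contra huv;
    move=> /eqP uv; apply/eqP/hfg; [left|right].
(* A pair of colour [i] separated by [h] would be separated by [f] and by [g], hence equal to both
   [d] and [d']. *)
have crossed_h : crossed h S \subset (crossed f S :&: crossed g S) :\ i.
  apply/subsetP=> j /crossedP[e Se /sep_h[fe ge]]; rewrite in_setD1 inE.
  apply/and3P; split; try by apply/crossedP; exists e.
  apply: contra dd' => /eqP ji; rewrite ji in Se.
  by rewrite -(fd e) // -(gd' e).
have i_fg : i \in crossed f S :&: crossed g S.
  by rewrite inE; apply/andP; split; apply/crossedP; [exists d|exists d'].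
have card_fg : #|crossed fg S| < _.+1 := subset_leq_card crossed_fg.
have card_h : #|crossed h S| < _.+1 := subset_leq_card crossed_h.
have card_UI := cardsUI (crossed f S) (crossed g S).
have card_I := cardsD1 i (crossed f S :&: crossed g S); rewrite i_fg in card_I.
(* With [a] and [b] colours crossed by [f] and [g], tightness gives at least [a + b + 2] values in
   total, whereas richness for [fg] and [h] allows at most [a + b + 1], the colour [i] being missing
   from [crossed h S]. *)
have := leq_add (leq_trans (richS _ fg) card_fg) (leq_trans (richS _ h) card_h).
move/(leq_trans le_fg)/(leq_trans (leq_add tight_f tight_g)).
rewrite !addnS !addSn !ltnS -card_UI card_I.
by rewrite add1n addnS ltnn.
Qed.

End ColouredPairs.

(** * Partition connectivity as richness *)

Section HedgePairs.

Variables (V : finType) (G : hedgegraph V).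

(** All possible trims, tagged by their hedge so that equal pairs from different hedges stay
    distinct. *)
Definition hedge_pairs : {set {set {set V}} * {set V}} :=
  [set p : {set {set V}} * {set V} |
    [&& p.1 \in hedges G, #|p.2| == 2 & [exists h in p.1, p.2 \subset h]]].

Lemma crossed_hedge_pairsP (T : eqType) (f : V -> T) (e : {set {set V}}) :
  reflect (e \in hedges G /\ exists2 h, h \in e & separates f h)
          (e \in crossed f hedge_pairs).
Proof.
apply: (iffP idP) => [/crossedP[d]|[Ge [h eh /separatesP[u [v [hu hv fuv]]]]]].
  rewrite inE /= => /and3P[Ge _ /exists_inP[h eh /subsetP dh]].
  case/separatesP=> u [v [du dv fuv]]; split=> //; exists h => //.
  by apply/separatesP; exists u, v; split=> //; apply: dh.
have uv : u != v by apply: contraNneq fuv => ->.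
apply/crossedP; exists [set u; v].
  rewrite inE /= Ge cards2 uv /=; apply/exists_inP; exists h => //.
  by rewrite subUset !sub1set hu.
by apply/separatesP; exists u, v; rewrite !inE !eqxx orbT.
Qed.

Lemma delta_pblock (P : {set {set V}}) :
  partition P [set: V] -> delta G P = crossed (pblock P) hedge_pairs.
Proof.
move=> partP; have tiP : trivIset P by case/and3P: partP.
have coverP x : x \in cover P by rewrite (cover_partition partP).
apply/setP=> e; apply/idP/crossed_hedge_pairsP => [|[Ge [h eh]]].
  rewrite inE => /andP[Ge /exists_inP[h eh /card_gt1P[A [B []]]]].
  rewrite !inE => /andP[PA /set0Pn[u]] + /andP[PB /set0Pn[v]].
  rewrite !inE => /andP[hu Au] /andP[hv Bv] AB.
  split=> //; exists h => //; apply/separatesP; exists u, v; split=> //.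
  by rewrite (def_pblock tiP PA Au) (def_pblock tiP PB Bv).
case/separatesP=> u [v [hu hv uv]]; rewrite inE Ge; apply/exists_inP.
exists h => //; apply/card_gt1P; exists (pblock P u), (pblock P v).
split=> //; rewrite inE pblock_mem //=; apply/set0Pn.
  by exists u; rewrite inE hu mem_pblock coverP.
by exists v; rewrite inE hv mem_pblock coverP.
Qed.

Lemma imset_pblock (P : {set {set V}}) :
  partition P [set: V] -> pblock P @: setT = P.
Proof.
move=> /and3P[/eqP coverP tiP nP0]; apply/setP=> A; apply/imsetP/idP.
  by case=> x _ ->; rewrite pblock_mem // coverP.
have [->|[x Ax] PA] := set_0Vmem A; first by rewrite (negPf nP0).
by exists x; rewrite ?(def_pblock tiP PA Ax).
Qed.

Lemma one_partition_connectedP : one_partition_connected G <-> rich hedge_pairs.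
Proof.
split=> [connG|/richP richG P partP]; last first.
  have := richG _ (pblock P).
  by rewrite imset_pblock // -delta_pblock // leq_subLR add1n.
(* The partition into fibres of [f] has as many parts as [f] has values, and its block map separates
   the same pairs. *)
apply/forallP=> f; pose P := preim_partition f [set: V].
have partP : partition P [set: V] := preim_partitionP f setT.
have pblockE x y : (pblock P x == pblock P y) = (f x == f y).
  have /and3P[/eqP coverP tiP _] := partP.
  rewrite eq_pblock // ?coverP ?inE //.
  by rewrite pblock_equivalence_partition ?inE // => ? ? ? _ _ _; split=> // /eqP->.
have /= := connG P partP; rewrite delta_pblock // leq_subLR add1n.
rewrite -{1}(imset_pblock partP) => leP.
apply: leq_trans (leq_trans leP _).
  by apply: leq_card_imset_factor => x y /eqP; rewrite pblockE => /eqP.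
rewrite ltnS; apply/subset_leq_card/crossed_factor => x y /eqP.
by rewrite -pblockE => /eqP.
Qed.

(** A map with [k] values separates at least [k - 1] edges of a connected graph; these come from
    distinct hedges, each with a hyperedge containing the edge. *)
Lemma connected_trimming_partition_connected (F : {set {set {set V}}})
    (sFG : F \subset hedges G) (t : trimming (sub_hedgegraph sFG)) :
  mg_connected (trimmed t) -> one_partition_connected G.
Proof.
move=> conn; apply/one_partition_connectedP/richP => T f.
apply: leq_trans (connected_card_separated (B := setT) f (card_trim t) _) _.
  move=> x y; rewrite (@eq_connect _ _ (mg_adj (trimmed t))) ?conn // => u v /=.
  by apply: eq_existsb => a; rewrite inE.
rewrite ltnS -(card_imset _ val_inj); apply/subset_leq_card/subsetP.
move=> _ /imsetP[a /setIdP[_ /separatesP[u [v [tu tv fuv]]]] ->].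
have [h [x [y [ah hx hy _ tE]]]] := trimP t a.
apply/crossed_hedge_pairsP; split; first exact: (subsetP sFG) (valP a).
have th : {subset trim t a <= h} by move=> z; rewrite tE !inE => /pred2P[]->.
by exists h => //; apply/separatesP; exists u, v; split=> //; apply: th.
Qed.

End HedgePairs.

(** * The spanning tree obtained from a minimal rich set *)

(** The rest of the cycle joins the ends of [a] and avoids [a], since the edges of a cycle are
    distinct. *)
Lemma mg_cycle_detour (V : finType) (M : multigraph V) (x : V) (a : mg_edge M)
    (c : seq (V * mg_edge M)) :
  mg_cycle ((x, a) :: c) ->
  forall u v, mg_ends a = [set u; v] ->
  connect [rel u v | [exists b in [set~ a], mg_ends b == [set u; v]]] u v.
Proof.
set adj := [rel u v | _]; case/and4P=> _ _ /= /andP[a_c _] cyc u v auv.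
have adj_sym : symmetric adj.
  by move=> y z /=; apply: eq_existsb => b; rewrite setUC.
have walk (p : V * mg_edge M) s :
    path [rel p q | mg_ends p.2 == [set p.1; q.1]] p (rcons s (x, a)) ->
    a \notin unzip2 (p :: s) -> connect adj p.1 x.
  elim: s p => [|q s IHs] p /= /andP[pE].
    rewrite inE => _ ap; apply: connect1 => /=; apply/exists_inP.
    by exists p.2; rewrite // !inE eq_sym.
  move=> qs; rewrite inE negb_or => /andP[ap aqs].
  apply: connect_trans (IHs _ qs aqs); apply: connect1 => /=.
  by apply/exists_inP; exists p.2; rewrite // !inE eq_sym.
(* A cycle of length one would make [a] a loop, against [card_mg_ends]. *)
case: c a_c cyc => [_ | q c a_c /andP[/eqP aE /walk/(_ a_c) qx]] /=.
  by rewrite setUid andbT => /eqP aE; have := card_mg_ends a; rewrite aE cards1.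
have xq : connect adj x q.1 by rewrite (sym_connect_sym adj_sym).
have u_xq : u \in [set x; q.1] by rewrite -aE auv !inE eqxx.
have v_xq : v \in [set x; q.1] by rewrite -aE auv !inE eqxx orbT.
by move: u_xq v_xq; rewrite !inE => /pred2P[]-> /pred2P[]->.
Qed.

Section Trim.

Variables (V : finType) (G : hedgegraph V).
Variable S : {set {set {set V}} * {set V}}.
Hypotheses (minS : minset (@rich V _) S) (sub_S : S \subset hedge_pairs G).

Let F : {set {set {set V}}} := fst @: S.

Let sFG : F \subset hedges G.
Proof.
apply/subsetP=> _ /imsetP[p /(subsetP sub_S) + ->].
by rewrite inE => /and3P[].
Qed.

(** The default [set0] is never reached: membership in [F] provides a pair in [S]. *)
Let pair (a : {e | e \in F}) : {set V} := odflt set0 [pick d | (val a, d) \in S].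

Let pair_in a : (val a, pair a) \in S.
Proof.
rewrite /pair; case: pickP => // noS.
have /imsetP[[e d] Sp aE] := valP a.
by have /negP[] := negbT (noS d); rewrite [val a]aE.
Qed.

Let pair_trims (a : {e | e \in F}) : trims (val a) (pair a).
Proof.
have /(subsetP sub_S) := pair_in a; rewrite inE => /and3P[_ /cards2P[u [v [uv pE]]]].
case/exists_inP=> h ah; rewrite pE subUset !sub1set => /andP[hu hv].
by exists h, u, v; split.
Qed.

Let t : trimming (sub_hedgegraph sFG) := @Trimming V (sub_hedgegraph sFG) pair pair_trims.

(** By minimality [S] has one pair per colour, so the pair that witnesses the crossing is the chosen
    one. *)
Let crossed_trimmed (T : eqType) (f : V -> T) e :
  e \in crossed f S ->
  exists2 a : mg_edge (trimmed t), val a = e & separates f (mg_ends a).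
Proof.
case/crossedP=> d Sd fd.
have Fe : e \in F by apply/imsetP; exists (e, d).
exists (exist _ e Fe) => //=.
by rewrite -(minset_rich_inj minS Sd (pair_in (exist _ e Fe))).
Qed.

Let trimmed_connected : mg_connected (trimmed t).
Proof.
have /minsetP[/richP richS _] := minS => x y.
(* The map to connected components separates no edge, so richness leaves it a single value. *)
pose f x : {set V} := [set y | connect (mg_adj (trimmed t)) x y].
have adj_sym : symmetric (mg_adj (trimmed t)).
  by move=> u v /=; apply: eq_existsb => a; rewrite setUC.
have f_adj u v : mg_adj (trimmed t) u v -> f u = f v.
  move=> uv; apply/setP=> z; rewrite !inE.
  exact: (same_connect (sym_connect_sym adj_sym) (connect1 uv)).
have no_crossed : crossed f S = set0.
  apply/setP=> e; rewrite [RHS]inE; apply/negP.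
  case/crossed_trimmed=> a _ /separatesP[u [v [au av /eqP[]]]].
  have [->//|uv] := eqVneq u v.
  apply: f_adj; apply/existsP; exists a.
  rewrite eq_sym eqEcard card_mg_ends cards2 uv andbT.
  by rewrite subUset !sub1set au.
have := richS _ f; rewrite no_crossed cards0 => /card_le1_eqP f1.
have /setP/(_ y) := f1 _ _ (imset_f f (in_setT x)) (imset_f f (in_setT y)).
by rewrite !inE connect0.
Qed.

Let trimmed_acyclic : mg_acyclic (trimmed t).
Proof.
move=> [//|[x a] c]; apply/negP=> cyc.
(* Without the cycle edge [a] the graph stays connected, so the remaining pairs are still rich,
   contradicting minimality. *)
have /minsetP[_ minS'] := minS; pose S' := S :\ (val a, pair a).
suff /minS'/(_ (subD1set _ _))/setP/(_ (val a, pair a)) : rich S'.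
  by rewrite (pair_in a) !inE eqxx.
apply/richP=> T f.
have := connected_card_separated (B := [set~ a]) f (@card_mg_ends V (trimmed t)).
move=> le; apply: leq_trans (le _) _ => [u v|].
  apply: connect_sub (trimmed_connected u v) => {}u {}v /existsP[b /eqP bE].
  have [ba|ba] := eqVneq b a.
    by apply: mg_cycle_detour cyc _ _ _; rewrite -ba.
  by apply/connect1/exists_inP; exists b; rewrite ?inE ?bE.
rewrite ltnS -(card_imset _ val_inj); apply/subset_leq_card/subsetP.
move=> _ /imsetP[b /setIdP[+ fb] ->]; rewrite in_setC1 => ba.
apply/crossedP; exists (pair b) => //; rewrite !inE pair_in andbT.
by apply: contra ba => /eqP[/val_inj->].
Qed.

Lemma minset_rich_trimming :
  exists (F : {set {set {set V}}}) (sFG : F \subset hedges G)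
    (t : trimming (sub_hedgegraph sFG)), spanning_tree (trimmed t).
Proof. by exists F, sFG, t. Qed.

End Trim.

Theorem theorem1p3 (V : finType) (G : hedgegraph V) :
  one_partition_connected G <->
  exists (F : {set {set {set V}}}) (sFG : F \subset hedges G)
    (t : trimming (sub_hedgegraph sFG)), spanning_tree (trimmed t).
Proof.
split=> [/one_partition_connectedP richG|[F [sFG [t [conn _]]]]].
  have [S minS sub_S] := minset_exists (P := @rich V _) richG.
  exact: minset_rich_trimming minS sub_S.
exact: connected_trimming_partition_connected conn.
Qed.
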